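(* Let $r,s,t$ be real numbers such that $$\Delta(r,s,t)=\frac{r^{3}t}{27}-\frac{r^{2}s^{2}}{108}+\frac{rst}{6}-\frac{s^{3}}{27}+\frac{t^{2}}{4}>0,$$ and let $\alpha,\omega_1,\omega_2$ be the three roots of $x^3-rx^2-sx-t=0$, with $\alpha$ the real root and $\omega_1,\omega_2$ the two complex conjugate nonreal roots. Let $V_0,V_1,V_2$ be arbitrary integers and let $\{V_n\}_{n\ge 0}$ be defined by $V_n=rV_{n-1}+sV_{n-2}+tV_{n-3}$ for $n\ge 3$. Put $$P=V_{2}-(\omega_{1}+\omega_{2})V_{1}+\omega_{1}\omega_{2}V_{0},\quad Q=V_{2}-(\alpha+\omega_{2})V_{1}+\alpha\omega_{2}V_{0},\quad R=V_{2}-(\alpha+\omega_{1})V_{1}+\alpha\omega_{1}V_{0}.$$ Then for every integer $n\ge 0$, $$P\alpha^{n+2}=\alpha^{2} V_{n+2}+\alpha(sV_{n+1}+tV_{n})+ tV_{n+1},$$ $$Q\omega_{1}^{n+2}=\omega_{1}^{2} V_{n+2}+\omega_{1}(sV_{n+1}+tV_{n})+ tV_{n+1},$$ $$R\omega_{2}^{n+2}=\omega_{2}^{2} V_{n+2}+\omega_{2}(sV_{n+1}+tV_{n})+ tV_{n+1}.$$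
   Context: $\{V_n\}$ is the generalized Tribonacci sequence of Shannon and Horadam with parameters $V_0,V_1,V_2,r,s,t$. The three identities are called the quadratic approximation of $\{V_n\}$. *)

(* Defs.v *)
From mathcomp Require Import all_boot all_order all_algebra.
From mathcomp Require Import reals.
From mathcomp.real_closed Require Export complex.

Set Implicit Arguments.
Unset Strict Implicit.
Unset Printing Implicit Defensive.

Import GRing.Theory.
Local Open Scope ring_scope.

Fixpoint gen_tribonacci (R : nzRingType) (r s t V0 V1 V2 : R) (n : nat) : R :=
  match n with
  | 0 => V0
  | 1 => V1
  | 2 => V2
  | ((k.+1 as k1).+1 as k2).+1 =>
      r * gen_tribonacci r s t V0 V1 V2 k2
      + s * gen_tribonacci r s t V0 V1 V2 k1
      + t * gen_tribonacci r s t V0 V1 V2 k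
  end.

Definition tribonacci_poly (R : nzRingType) (r s t : R) : {poly R} :=
  'X^3 - r *: 'X^2 - s *: 'X - t%:P.

(* [q ^+ 2 / 4 + p ^+ 3 / 27] for the depressed cubic [y^3 + p y + q] obtained
   from [tribonacci_poly r s t]: it is positive exactly when the cubic has one
   real root and two nonreal ones. *)
Definition Delta (F : fieldType) (r s t : F) : F :=
  r ^+ 3 * t / 27%:R - r ^+ 2 * s ^+ 2 / 108%:R + r * s * t / 6%:R
  - s ^+ 3 / 27%:R + t ^+ 2 / 4%:R.

(* Main.v *)
Require Import Defs.
From mathcomp Require Import all_boot all_order all_algebra.
From mathcomp Require Import reals ring.
From mathcomp.real_closed Require Import complex.

Import GRing.Theory Num.Theory.
Local Open Scope ring_scope.
Local Open Scope complex_scope.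

(** Once Vieta's relations express [r], [s], [t] through the three roots x, y, z, the characteristic
    operator factors: applying to V the factor that kills the modes y and z leaves a sequence W with
    W_(n+1) = x W_n. Hence W_n = W_0 x^n, where W_0 is P, Q or R according to which root is x, and
    x^2 W_n rearranges into the stated quadratic expression ([quadratic_approximation]). Vieta's
    relations come from the three roots being pairwise distinct ([vieta_distinct_roots]): one is
    real, the other two are nonreal and conjugate. *)

Lemma root_tribonacci_poly (R : comNzRingType) (r s t x : R) :
  root (tribonacci_poly r s t) x = (x ^+ 3 - r * x ^+ 2 - s * x - t == 0).
Proof.
by rewrite rootE !(hornerD, hornerN, hornerZ, hornerC, hornerXn, hornerX).
Qed.

(** Divided differences of the cubic vanish at distinct roots: the second one gives [r], then a
    first one gives [s], and the cubic itself gives [t]. Cancelling the nonzero differences of roots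
    needs only an integral domain. *)
Lemma vieta_distinct_roots (F : idomainType) (r s t x y z : F) :
  x != y -> x != z -> y != z ->
  root (tribonacci_poly r s t) x -> root (tribonacci_poly r s t) y ->
  root (tribonacci_poly r s t) z ->
  [/\ r = x + y + z, s = - (x * y + x * z + y * z) & t = x * y * z].
Proof.
move=> xy xz yz; rewrite !root_tribonacci_poly => /eqP Hx /eqP Hy /eqP Hz.
(* First divided difference: subtracting the two equations eliminates [t] and leaves a multiple of
   [u - v]. *)
have quotient u v : u != v -> u ^+ 3 - r * u ^+ 2 - s * u - t = 0 ->
    v ^+ 3 - r * v ^+ 2 - s * v - t = 0 ->
    u ^+ 2 + u * v + v ^+ 2 - r * (u + v) - s = 0.
  move=> uv Hu Hv; apply: (@mulfI _ (u - v)); first by rewrite subr_eq0.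
  rewrite mulr0 -[RHS](subrr 0) -{1}Hu -Hv; ring.
have Hxy := quotient _ _ xy Hx Hy; have Hxz := quotient _ _ xz Hx Hz.
have def_r : r = x + y + z.
  apply/esym/eqP; rewrite -subr_eq0; apply/eqP.
  (* Second divided difference: [Hxy] minus [Hxz] is [y - z] times [x + y + z - r]. *)
  apply: (@mulfI _ (y - z)); first by rewrite subr_eq0.
  rewrite mulr0 -[RHS](subrr 0) -{1}Hxy -Hxz; ring.
have def_s : s = - (x * y + x * z + y * z).
  by apply/eqP; rewrite -subr_eq0 -oppr_eq0 -Hxy def_r; apply/eqP; ring.
split=> //; apply/eqP; rewrite -subr_eq0 -oppr_eq0 -Hx def_s def_r.
by apply/eqP; ring.
Qed.

(* W_n = V_(n+2) - (y + z) V_(n+1) + y z V_n is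
   geometric of ratio x, and both sides of the conclusion equal x^2 W_n. *)
Lemma quadratic_approximation (F : comNzRingType) (r s t x y z : F)
    (V : nat -> F) :
  r = x + y + z -> s = - (x * y + x * z + y * z) -> t = x * y * z ->
  (forall n, V n.+3 = r * V n.+2 + s * V n.+1 + t * V n) ->
  forall n, (V 2 - (y + z) * V 1 + y * z * V 0) * x ^+ (n + 2) =
    x ^+ 2 * V (n + 2)%N + x * (s * V (n + 1)%N + t * V n) + t * V (n + 1)%N.
Proof.
move=> def_r def_s def_t recV n.
have geometric : V n.+2 - (y + z) * V n.+1 + y * z * V n =
    (V 2 - (y + z) * V 1 + y * z * V 0) * x ^+ n.
  elim: n => [|n IHn]; first by rewrite mulr1.
  (* W_(n+1) = x W_n, since r - (y + z) = x, s + y z = - x (y + z) and t = x y z. *)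
  by rewrite exprSr mulrA -IHn recV def_r def_s def_t; ring.
by rewrite exprD mulrA -geometric addn1 addn2 def_s def_t; ring.
Qed.

Lemma nonreal_neq_complex (K : rcfType) (a : K) (w : K[i]) :
  w \isn't Num.real -> a%:C != w.
Proof. by apply: contraNneq => <-; apply/complex_realP; exists a. Qed.

(** Equality would give b = - b for the imaginary part b, so 2 b = 0 and b = 0 in characteristic
    zero. *)
Lemma nonreal_neq_conjc (K : rcfType) (w : K[i]) :
  w \isn't Num.real -> w != conjc w.
Proof.
case: w => a b; apply: contraNneq => /eqP.
by rewrite eq_complex /= eqxx -subr_eq0 opprK -mulr2n mulrn_eq0 complex_real.
Qed.

Theorem mainTheorem2 (K : realType) (r s t : K)
    (Delta_gt0 : 0 < Delta r s t)
    (alpha : K) (omega1 omega2 : K[i])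
    (alpha_root : root (tribonacci_poly r s t) alpha)
    (omega1_root :
       root (map_poly (real_complex K) (tribonacci_poly r s t)) omega1)
    (omega2_root :
       root (map_poly (real_complex K) (tribonacci_poly r s t)) omega2)
    (omega1_nonreal : omega1 \isn't Num.real)
    (omega2_nonreal : omega2 \isn't Num.real)
    (omega_conj : omega2 = conjc omega1)
    (V0 V1 V2 : int) :
  let a : K[i] := alpha%:C in
  let V (n : nat) : K[i] :=
    (gen_tribonacci r s t V0%:~R V1%:~R V2%:~R n)%:C in
  let P := V 2%N - (omega1 + omega2) * V 1%N + omega1 * omega2 * V 0%N in
  let Q := V 2%N - (a + omega2) * V 1%N + a * omega2 * V 0%N in
  let R := V 2%N - (a + omega1) * V 1%N + a * omega1 * V 0%N in
  forall n : nat,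
  [/\ P * a ^+ (n + 2) =
        a ^+ 2 * V (n + 2)%N
        + a * (s%:C * V (n + 1)%N + t%:C * V n) + t%:C * V (n + 1)%N,
      Q * omega1 ^+ (n + 2) =
        omega1 ^+ 2 * V (n + 2)%N
        + omega1 * (s%:C * V (n + 1)%N + t%:C * V n) + t%:C * V (n + 1)%N
    & R * omega2 ^+ (n + 2) =
        omega2 ^+ 2 * V (n + 2)%N
        + omega2 * (s%:C * V (n + 1)%N + t%:C * V n) + t%:C * V (n + 1)%N].
Proof.
move=> a V P Q R n.
set p := map_poly _ _ in omega1_root omega2_root.
(* All three roots are placed on one cubic over [K[i]], so that Vieta's relations apply there. *)
have def_p : p = tribonacci_poly r%:C s%:C t%:C.
  by rewrite /p /tribonacci_poly !rmorphB /= !map_polyZ map_polyC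
    !map_polyXn map_polyX.
have a_root : root p a by rewrite fmorph_root.
rewrite def_p in a_root omega1_root omega2_root.
have a_omega1 : a != omega1 by exact: nonreal_neq_complex.
have a_omega2 : a != omega2 by exact: nonreal_neq_complex.
have omega12 : omega1 != omega2 by rewrite omega_conj nonreal_neq_conjc.
have [def_r def_s def_t] := vieta_distinct_roots _ _ _ _ _ _ _ a_omega1 a_omega2 omega12
  a_root omega1_root omega2_root.
have recV m : V m.+3 = r%:C * V m.+2 + s%:C * V m.+1 + t%:C * V m.
  by rewrite /V -!rmorphM -!rmorphD.
split.
- exact: quadratic_approximation _ _ _ _ _ _ _ _ def_r def_s def_t recV n.
(* The same lemma with [omega1] as the distinguished root. Vieta's relations are symmetric, so
   [ring] only reorders the roots; [r%:C] is given because the conclusion of the lemma does not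
   determine it. *)
- by apply: (quadratic_approximation _ r%:C) recV n;
    rewrite ?def_r ?def_s ?def_t; ring.
- by apply: (quadratic_approximation _ r%:C) recV n;
    rewrite ?def_r ?def_s ?def_t; ring.
Qed.
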